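(* Let $\mathcal P$ be a Preisach operator with weighting function $\mu$ on the Preisach plane $P=\{(\alpha,\beta)\in\mathbb R^2\mid\alpha>\beta\}$. Assume that there exist a point $(\alpha_0,\beta_0)\in P$ with $\alpha_0>\beta_0$ and three values $\alpha_{1^-}<\alpha_1<\alpha_{1^+}$ with $\beta_0<\alpha_{1^-}$ and $\alpha_{1^+}<\alpha_0$ such that, writing $$\Omega_{a}=\{(\alpha,\beta)\in P\;|\;a<\alpha<\alpha_0,\ \beta_0<\beta<a\}\qquad\text{for } a\in\{\alpha_{1^-},\alpha_1,\alpha_{1^+}\},$$ one has $$\iint_{\Omega_{\alpha_1}}\mu(\alpha,\beta)\,d\alpha\,d\beta=0,\qquad \iint_{\Omega_{\alpha_{1^-}}}\mu(\alpha,\beta)\,d\alpha\,d\beta\neq0,\qquad \iint_{\Omega_{\alpha_{1^+}}}\mu(\alpha,\beta)\,d\alpha\,d\beta\neq0.$$ Then $\mathcal P$ is a multi-loop hysteresis operator.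
   Context: $AC(\mathbb R_+,\mathbb R)$ denotes the absolutely continuous functions and $C_{\mathrm{pw}}$ the piecewise continuous functions; $\mathbb R_+=[0,\infty)$. ''Monotonically increasing/decreasing'' is meant in the weak sense. Relay operator: for $\alpha>\beta$ and $r_0\in\{-1,1\}$, $(\mathcal R^{\circlearrowleft}_{\alpha,\beta}(u,r_0))(t)=+1$ if $u(t)>\alpha$; $=-1$ if $u(t)<\beta$; $=(\mathcal R^{\circlearrowleft}_{\alpha,\beta}(u,r_0))(t_-)$ (the previous state is kept) if $\beta\le u(t)\le\alpha$ and $t>0$; $=r_0$ if $\beta\le u(t)\le\alpha$ and $t=0$. Preisach operator: $P:=\{(\alpha,\beta)\in\mathbb R^2\mid\alpha>\beta\}$ is the Preisach plane. The set of interfaces $\mathcal I$ consists of the monotonically decreasing staircase curves $L=\{\sigma(\gamma)\mid\gamma\in\mathbb R_+\}$, where $\sigma$ is a continuous map from $\mathbb R_+$ to $P$ (with starting point on the diagonal $\alpha=\beta$) such that $\lim_{\gamma\to\infty}\|\sigma(\gamma)\|=\infty$ and $\sigma(0)=(a,a)$ for some $a\in\mathbb R$; monotonically decreasing means that for all $(\alpha_1,\beta_1),(\alpha_2,\beta_2)\in L$, $\beta_1\le\beta_2$ implies $\alpha_1\ge\alpha_2$. For $L_0\in\mathcal I$ and $(\alpha,\beta)\in P$, put $r_{\alpha,\beta}(L_0)=+1$ if $L_0\cap\{(\alpha_1,\beta_1)\mid\alpha\le\alpha_1,\ \beta\le\beta_1\}\neq\emptyset$ and $r_{\alpha,\beta}(L_0)=-1$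 otherwise. The Preisach operator with weighting function $\mu\in C_{\mathrm{pw}}(P,\mathbb R)$ (of arbitrary sign, and integrable on $P$ so that the integral is well-defined) is $$(\mathcal P(u,L_0))(t)=\iint_{(\alpha,\beta)\in P}\mu(\alpha,\beta)\,\big(\mathcal R^{\circlearrowleft}_{\alpha,\beta}(u,r_{\alpha,\beta}(L_0))\big)(t)\,d\alpha\,d\beta,$$ for $u\in AC(\mathbb R_+,\mathbb R)$, $L_0\in\mathcal I$. The initial interface is always assumed consistent with the input: $(u(0),u(0))\in L_0$. For specified initial interface it is a hysteresis operator (a causal and rate-independent operator) $\Phi(u)=\mathcal P(u,L_0)$. Hysteresis loop: let $u\in AC(\mathbb R_+,\mathbb R)$ be periodic with period $T>0$, with one maximum $u_{\max}$ and one minimum $u_{\min}$ in its periodic interval (over a suitable interval of length $T$, $u$ increases monotonically from $u_{\min}$ to $u_{\max}$ and then decreases monotonically back to $u_{\min}$), and let $y$ be the corresponding output. Assume there is $t_p\ge0$ such that $y$ is periodic (with period $T$) on $[t_p,\infty)$. The orbit $\mathcal H_{u,y}=\{(u(t),y(t))\mid t\in[t_p,\infty)\}$ is called a hysteresis loop if there exists $\upsilon\in\mathbb R$ such that the set $\{(\upsilon,\gamma)\in\mathcal H_{u,y}\mid\gamma\in\mathbb R\}$ has exactly two elements. Choosing $t_1\ge t_p$ and $t_1<t_2<t_1+T$ such that $u$ is monotonically increasing on $[t_1,t_2]$ and monotonically decreasing on $[t_2,t_1+T]$ (so $u(t_1)=u(t_1+T)=u_{\min}$, $u(t_2)=u_{\max}$),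 set $\mathcal H^+_{u,y}=\{(u(t),y(t))\mid t\in[t_1,t_2]\}$ and $\mathcal H^-_{u,y}=\{(u(t),y(t))\mid t\in[t_2,t_1+T]\}$. Multi-loop hysteresis operator: a hysteresis operator is called a multi-loop hysteresis operator if there exists a hysteresis loop $\mathcal H_{u,y}$, with $y$ the output for the input $u$, for which there is at least one (nonempty) maximal connected subset $C$ of $\mathcal H^+_{u,y}\cap\mathcal H^-_{u,y}$ (i.e. a connected component of this intersection) such that $u_c\neq u_{\min}$ and $u_c\neq u_{\max}$ for every $(u_c,y_c)\in C$. For the Preisach operator, the output is $y=\mathcal P(u,L_0)$ with an initial interface $L_0\in\mathcal I$ satisfying $(u(0),u(0))\in L_0$. *)

(* Defs.v *)
From HB Require Import structures.
From mathcomp Require Import all_boot all_order all_algebra.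
From mathcomp Require Import all_classical all_reals all_analysis.

Set Implicit Arguments.
Unset Strict Implicit.
Unset Printing Implicit Defensive.

Import Order.TTheory GRing.Theory Num.Theory.
Import numFieldNormedType.Exports.

Local Open Scope classical_set_scope.
Local Open Scope ring_scope.

(* Time signals on R_+ = [0, +oo[ are total functions R -> R of which only the
   values at nonnegative times are ever used; likewise only the values of a
   weighting function on the Preisach plane are used. Points of the plane are
   pairs p = (alpha, beta). *)

Section Signals.
Context {R : realType}.
Implicit Types (u y phi : R -> R) (D : set (R -> R)).

(* Absolute continuity on the unbounded interval R_+ is, as usual, absolute
   continuity on each compact interval [0, tau]. *)
Definition AC_Rplus u : Prop :=
  forall tau e : R, 0 < tau -> 0 < e -> exists2 d : R, 0 < d &
    forall (n : nat) (a b : nat -> R),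
      (forall i, (i < n)%N -> 0 <= a i /\ a i <= b i /\ b i <= tau) ->
      trivIset `I_n (fun i => `]a i, b i[%classic) ->
      \sum_(i < n) (b i - a i) < d ->
      \sum_(i < n) `|u (b i) - u (a i)| < e.

Definition time_transformation phi : Prop :=
  [/\ {within `[0, +oo[, continuous phi},
      {in `[0, +oo[ &, {homo phi : s t / s <= t}},
      phi 0 = 0
    & phi t @[t --> +oo] --> +oo].

Definition causal D (Phi : (R -> R) -> R -> R) : Prop :=
  forall u1 u2, D u1 -> D u2 -> forall tau, 0 <= tau ->
    (forall t, 0 <= t <= tau -> u1 t = u2 t) ->
    forall t, 0 <= t <= tau -> Phi u1 t = Phi u2 t.

(* Absolute continuity is not preserved by arbitrary time transformations, so
   membership of the transformed input in the domain is a side condition. *)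
Definition rate_independent D (Phi : (R -> R) -> R -> R) : Prop :=
  forall u phi, D u -> time_transformation phi -> D (u \o phi) ->
    forall t, 0 <= t -> Phi (u \o phi) t = Phi u (phi t).

Definition hysteresis_operator D (Phi : (R -> R) -> R -> R) : Prop :=
  causal D Phi /\ rate_independent D Phi.

Definition periodic_from (t0 T : R) (f : R -> R) : Prop :=
  forall t, t0 <= t -> f (t + T) = f t.

Definition graph_on (A : set R) u y : set (R * R) := [set (u t, y t) | t in A].

Definition orbit (tp : R) u y : set (R * R) := graph_on `[tp, +oo[ u y.

Definition is_loop (H : set (R * R)) : Prop :=
  exists v : R, ([set p | H p /\ p.1 = v] #= `I_2)%card.

Definition rises_then_falls (T t1 t2 : R) u : Prop :=
  [/\ t1 < t2 < t1 + T,
      {in `[t1, t2] &, {homo u : s t / s <= t}}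
    & {in `[t2, t1 + T] &, {homo u : s t /~ s <= t}}].

(* y, the output for the periodic input u, gives a hysteresis loop whose
   rising and falling branches have a crossing component away from
   u_min = u t1 and u_max = u t2. *)
Definition multi_loop_pair u y : Prop :=
  exists T tp t1 t2 : R,
    [/\ [/\ 0 < T, periodic_from 0 T u, 0 <= tp & periodic_from tp T y],
        is_loop (orbit tp u y),
        tp <= t1, rises_then_falls T t1 t2 u
      & let X := graph_on `[t1, t2] u y `&` graph_on `[t2, t1 + T] u y in
        exists2 p, X p &
          forall q, connected_component X p q -> q.1 != u t1 /\ q.1 != u t2].

(* Operators parametrised by an initial state in J; Phi x is defined on D x. *)
Definition multi_loop_hysteresis_operator (I : Type) (J : set I)
    (D : I -> set (R -> R)) (Phi : I -> (R -> R) -> R -> R) : Prop :=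
  (forall x, J x -> hysteresis_operator (D x) (Phi x)) /\
  (exists x u, [/\ J x, D x u & multi_loop_pair u (Phi x u)]).

End Signals.

Section Relay.
Context {R : realType}.
Implicit Types (alpha beta t s : R) (u : R -> R).

(* The left-limit clause of the relay alone does not determine the output (a
   left-continuous switch could occur inside the dead zone), so the memory is
   made explicit: the relay is +1 if it was switched on at some past time and
   not switched off since, -1 in the symmetric case, and r0 if it was never
   switched. The lemmas below recover the recursive description. *)
Definition relay alpha beta u r0 t : R :=
  if `[< exists s, [/\ 0 <= s <= t, alpha < u s
                     & forall z, s <= z <= t -> beta <= u z] >] then 1
  else if `[< exists s, [/\ 0 <= s <= t, u s < beta
                          & forall z, s <= z <= t -> u z <= alpha] >] then -1
  else r0.

Lemma relay_gt alpha beta u r0 t : beta < alpha -> 0 <= t ->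
  alpha < u t -> relay alpha beta u r0 t = 1.
Proof.
move=> ba t0 ut; rewrite /relay asboolT//; exists t; split => //.
  by rewrite t0 lexx.
by move=> z ztt; rewrite -(le_anti ztt) (le_trans (ltW ba) (ltW ut)).
Qed.

Lemma relay_lt alpha beta u r0 t : beta < alpha -> 0 <= t ->
  u t < beta -> relay alpha beta u r0 t = -1.
Proof.
move=> ba t0 ut; rewrite /relay asboolF; last first.
  move=> [s [/andP[_ st] _ /(_ t)]]; rewrite st lexx => /(_ isT).
  by rewrite leNgt ut.
rewrite asboolT//; exists t; split => //; first by rewrite t0 lexx.
by move=> z ztt; rewrite -(le_anti ztt) (le_trans (ltW ut) (ltW ba)).
Qed.

Lemma relay0 alpha beta u r0 : beta <= u 0 <= alpha ->
  relay alpha beta u r0 0 = r0.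
Proof.
move=> /andP[bu ua]; rewrite /relay !asboolF//.
- by move=> [s [/le_anti <-]]; rewrite ltNge bu.
- by move=> [s [/le_anti <-]]; rewrite ltNge ua.
Qed.

Lemma relay_keep alpha beta u r0 s t : 0 <= s -> s <= t ->
  (forall z, s < z <= t -> beta <= u z <= alpha) ->
  relay alpha beta u r0 t = relay alpha beta u r0 s.
Proof.
move=> s0 st ust.
have E : forall P Q : R -> Prop, (forall z, s < z <= t -> ~ P z) ->
    (forall z, s < z <= t -> Q z) ->
    `[< exists x, [/\ 0 <= x <= t, P x & forall z, x <= z <= t -> Q z] >] =
    `[< exists x, [/\ 0 <= x <= s, P x & forall z, x <= z <= s -> Q z] >].
  move=> P Q nP yQ; apply/asbool_equiv_eq; split.
  - move=> [x [/andP[x0 xt] Px Qx]]; exists x; split => //.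
    + rewrite x0/= leNgt; apply/negP => sx.
      by apply: (nP x) => //; rewrite sx.
    + by move=> z /andP[xz zs]; apply: Qx; rewrite xz (le_trans zs).
  - move=> [x [/andP[x0 xs] Px Qx]]; exists x; split => //.
    + by rewrite x0 (le_trans xs).
    + move=> z /andP[xz zt]; have [zs|sz] := leP z s.
        by apply: Qx; rewrite xz.
      by apply: yQ; rewrite sz.
rewrite /relay.
rewrite (E (fun x => is_true (alpha < u x)) (fun z => is_true (beta <= u z))).
- rewrite (E (fun x => is_true (u x < beta)) (fun z => is_true (u z <= alpha)))//.
  + by move=> z /ust/andP[bz _]; rewrite ltNge bz.
  + by move=> z /ust/andP[].
- by move=> z /ust/andP[_ zb]; rewrite ltNge zb.
- by move=> z /ust/andP[].
Qed.

Lemma relay_left alpha beta u r0 t : beta < alpha ->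
  {within `[0, +oo[, continuous u} -> 0 < t -> beta <= u t <= alpha ->
  relay alpha beta u r0 s @[s --> t^'-] --> relay alpha beta u r0 t.
Proof.
move=> ba /continuous_within_itvcyP[cu _] t0 /andP[bu ua].
have {}cu : u x @[x --> t] --> u t by apply: cu; rewrite in_itv/= t0.
suff [s0 [s00 s0t H]] : exists s0, [/\ 0 <= s0, s0 < t & forall s, s0 <= s <= t ->
    relay alpha beta u r0 s = relay alpha beta u r0 t].
  apply: cvg_near_cst; near=> s; apply: H; apply/andP; split => //.
  by near: s; apply: nbhs_left_ge.
have /orP[bt|ta] : (beta < u t) || (u t < alpha).
- by case: ltP => //= tb; rewrite (le_lt_trans tb).
- have [d /= d0 Hd] : \forall x \near t, beta < u x.
    by apply: (cu [set y | beta < y]); exact: lt_nbhsr.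
  pose x0 := Num.max 0 (t - d / 2).
  have x0t : x0 < t by rewrite gt_max t0/= ltrBlDr ltrDl divr_gt0.
  have x00 : 0 <= x0 by rewrite le_max lexx.
  have Hx z : x0 <= z <= t -> beta < u z.
    move=> /andP[xz zt]; apply: Hd => /=; rewrite ger0_norm ?subr_ge0//.
    rewrite (@le_lt_trans _ _ (t - x0)) ?lerB//.
    rewrite ltrBlDl -ltrBlDr lt_max ltrD2l ltrN2.
    by apply/orP; right; rewrite ltr_pdivrMr// mulr_natr mulr2n ltrDl.
  have [[s0 [s0t s0a]]|nH] := pselect (exists s0, x0 <= s0 < t /\ alpha < u s0).
    move/andP: s0t => [xs0 s0t]; exists s0; split => //; first exact: le_trans xs0.
    have H s : s0 <= s <= t -> relay alpha beta u r0 s = 1.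
      move=> /andP[ss st]; rewrite /relay asboolT//; exists s0; split => //.
        by rewrite (le_trans x00 xs0).
      move=> z /andP[sz zs]; apply/ltW/Hx.
      by rewrite (le_trans xs0 sz) (le_trans zs st).
    by move=> s st; rewrite !H// lexx ltW.
  exists x0; split => // s /andP[xs st]; apply/esym/relay_keep => //.
    exact: le_trans xs.
  move=> z /andP[sz zt]; rewrite ltW/=; last by rewrite Hx// zt (le_trans xs (ltW sz)).
  move: zt; rewrite le_eqVlt => /predU1P[->//|zt].
  rewrite leNgt; apply/negP => az; apply: nH; exists z; split => //.
  by rewrite zt (le_trans xs (ltW sz)).
- have [d /= d0 Hd] : \forall x \near t, u x < alpha.
    by apply: (cu [set y | y < alpha]); exact: lt_nbhsl.
  pose x0 := Num.max 0 (t - d / 2).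
  have x0t : x0 < t by rewrite gt_max t0/= ltrBlDr ltrDl divr_gt0.
  have x00 : 0 <= x0 by rewrite le_max lexx.
  have Hx z : x0 <= z <= t -> u z < alpha.
    move=> /andP[xz zt]; apply: Hd => /=; rewrite ger0_norm ?subr_ge0//.
    rewrite (@le_lt_trans _ _ (t - x0)) ?lerB//.
    rewrite ltrBlDl -ltrBlDr lt_max ltrD2l ltrN2.
    by apply/orP; right; rewrite ltr_pdivrMr// mulr_natr mulr2n ltrDl.
  have [[s0 [s0t s0a]]|nH] := pselect (exists s0, x0 <= s0 < t /\ u s0 < beta).
    move/andP: s0t => [xs0 s0t]; exists s0; split => //; first exact: le_trans xs0.
    have H s : s0 <= s <= t -> relay alpha beta u r0 s = -1.
      move=> /andP[ss st]; rewrite /relay asboolF; last first.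
        move=> [x [/andP[_ xs] ax bx]]; have [xs1|sx] := leP x s0.
          by have := bx s0; rewrite xs1 ss leNgt s0a => /(_ isT).
        have := Hx x; rewrite (le_trans xs0 (ltW sx)) (le_trans xs st) => /(_ isT).
        by rewrite ltNge (ltW ax).
      rewrite asboolT//; exists s0; split => //.
        by rewrite (le_trans x00 xs0).
      move=> z /andP[sz zs]; apply/ltW/Hx.
      by rewrite (le_trans xs0 sz) (le_trans zs st).
    by move=> s st; rewrite !H// lexx ltW.
  exists x0; split => // s /andP[xs st]; apply/esym/relay_keep => //.
    exact: le_trans xs.
  move=> z /andP[sz zt]; apply/andP; split; last first.
    by apply/ltW; rewrite Hx// zt (le_trans xs (ltW sz)).
  move: zt; rewrite le_eqVlt => /predU1P[->//|zt].
  rewrite leNgt; apply/negP => az; apply: nH; exists z; split => //.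
  by rewrite zt (le_trans xs (ltW sz)).
Unshelve. all: by end_near. Qed.

End Relay.

Notation lebesgue2 R := (@lebesgue_measure R \x @lebesgue_measure R)%E.

Section Preisach.
Context {R : realType}.
Implicit Types (mu : R * R -> R) (L : set (R * R)) (p q : R * R).

Definition preisach_plane : set (R * R) := [set p | p.2 < p.1].

(* A locally finite subdivision of the plane P into open regions with null
   boundaries, on each of which mu extends continuously up to the part of the
   boundary lying in P; the values of mu on the boundaries are free. *)
Definition piecewise_continuous mu : Prop :=
  exists U : nat -> set (R * R),
    [/\ (forall i, open (U i) /\ U i `<=` preisach_plane),
        trivIset setT U,
        preisach_plane `<=` \bigcup_i closure (U i),
        (forall K, compact K -> K `<=` preisach_plane ->
           finite_set [set i | U i `&` K !=set0])
      & forall i, (lebesgue2 R).-negligible (closure (U i) `\` U i) /\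
          exists g : R * R -> R,
            {within closure (U i) `&` preisach_plane, continuous g} /\
            {in U i, mu =1 g}].

Definition weighting_function mu : Prop :=
  piecewise_continuous mu /\ (lebesgue2 R).-integrable preisach_plane (EFin \o mu).

(* The starting point of the curve is the only parameter value sent to the
   diagonal, which is not part of the open half-plane P. *)
Definition interface : set (set (R * R)) :=
  [set L | (exists sigma : R -> R * R,
      [/\ {within `[0, +oo[, continuous sigma},
          (exists a, sigma 0 = (a, a)),
          (forall g, 0 < g -> preisach_plane (sigma g)),
          `|sigma g| @[g --> +oo] --> +oo
        & L = sigma @` `[0, +oo[]) /\
    (forall p q, L p -> L q -> p.2 <= q.2 -> q.1 <= p.1)].

Definition initial_relay L p : R :=
  if `[< exists q, [/\ L q, p.1 <= q.1 & p.2 <= q.2] >] then 1 else -1.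

Definition preisach mu L (u : R -> R) (t : R) : R :=
  \int[lebesgue2 R]_(p in preisach_plane)
    (mu p * relay p.1 p.2 u (initial_relay L p) t).

Definition consistent_inputs L : set (R -> R) :=
  [set u | AC_Rplus u /\ L (u 0, u 0)].

Definition preisach_multi_loop mu : Prop :=
  multi_loop_hysteresis_operator interface consistent_inputs (preisach mu).

Definition Omega (alpha0 beta0 a : R) : set (R * R) :=
  [set p | preisach_plane p /\ a < p.1 < alpha0 /\ beta0 < p.2 < a].

End Preisach.

(* Main.v *)
Require Import Defs.
From mathcomp Require Import all_boot all_order all_algebra.
From mathcomp Require Import all_classical all_reals all_analysis.
From mathcomp Require Import finmap measurable_realfun lra.

Import Order.TTheory GRing.Theory Num.Theory.
Import numFieldNormedType.Exports.

Local Open Scope classical_set_scope.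
Local Open Scope ring_scope.

(* Put a = alpha0, b = beta0 and drive the operator with the input
   u t = (a + b) / 2 + (a - b) / 2 * cos t, starting from the vertical interface
   through (a, a). Once the minimum b has been visited, the relay at
   (alpha, beta) is on, at input value v,
   - along rising branches, iff (alpha <= a and beta <= b) or alpha < v;
   - along falling branches, iff (alpha <= a and beta <= b) or
     (alpha < a and beta <= v).
   Hence the two outputs at v differ by twice the integral of mu over Omega_v,
   and the branches meet exactly over the zeros v of that integral. A connected
   component of the crossing set projects to an interval of such zeros, so the
   one over alpha1 stays strictly between alpha1m and alpha1p. *)

(** * Relay output on monotone branches, causality and rate independence *)

Section Relay.
Context {R : realType}.
Implicit Types (alpha beta a b t s r : R) (u : R -> R).

Lemma relay_on alpha beta u r t :
  (exists s, [/\ 0 <= s <= t, alpha < u s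
               & forall z, s <= z <= t -> beta <= u z]) ->
  relay alpha beta u r t = 1.
Proof. by move=> H; rewrite /relay asboolT. Qed.

(** The on-clause is tested first in [relay], so it has to be refuted: a switch-on before [s] is
    undone by the value below [beta] at [s], and a later one would exceed [alpha]. *)
Lemma relay_off alpha beta u r t :
  (exists s, [/\ 0 <= s <= t, u s < beta
               & forall z, s <= z <= t -> u z <= alpha]) ->
  relay alpha beta u r t = -1.
Proof.
move=> [s [/andP[s0 st] usb ua]]; rewrite /relay asboolF; last first.
  move=> [x [/andP[x0 xt] aux bu]]; have [xs|sx] := leP x s.
    by have := bu s; rewrite xs st leNgt usb => /(_ isT).
  by have := ua x; rewrite (ltW sx) xt leNgt aux => /(_ isT).
by rewrite asboolT//; exists s; split => //; rewrite s0.
Qed.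

(** Either the on-clause or the initial state gives 1, since the off-clause cannot hold. *)
Lemma relay_never_off alpha beta u t :
  (forall z, 0 <= z <= t -> beta <= u z) -> relay alpha beta u 1 t = 1.
Proof.
move=> bu; rewrite /relay; case: ifP => // _; rewrite asboolF//.
by move=> [s [s0t usb _]]; move: (bu s s0t); rewrite leNgt usb.
Qed.

Lemma relay_never_on alpha beta u t :
  (forall z, 0 <= z <= t -> u z <= alpha) -> relay alpha beta u (-1) t = -1.
Proof.
move=> ua; rewrite /relay asboolF; first by case: ifP.
by move=> [s [s0t aus _]]; move: (ua s s0t); rewrite leNgt aus.
Qed.

(** If [alpha > a] the relay starts off and is never switched on; if [alpha <= a] and [beta <= b] it
    starts on and is never switched off. Every other relay is off at the minimum reached at [s], and
    as [u] stays below [u t] since then, only the comparison of [alpha] with [u t] matters. *)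
Lemma relay_rising alpha beta a b u s t : beta < alpha ->
  (forall z, 0 <= z -> b <= u z <= a) -> 0 <= s <= t -> u s = b ->
  (forall z, s <= z <= t -> u z <= u t) ->
  relay alpha beta u (if alpha <= a then 1 else -1) t =
  if (alpha <= a) && (beta <= b) || (alpha < u t) then 1 else -1.
Proof.
move=> ba uab /andP[s0 st] usb umon; have t0 := le_trans s0 st.
have [aa|aa] /= := leP alpha a; last first.
  rewrite relay_never_on; last first.
    by move=> z /andP[/uab/andP[_ uz] _]; rewrite (le_trans uz)// ltW.
  have /uab/andP[_ ut] := t0.
  by case: ltP => // aut; move: (lt_le_trans aut ut); rewrite ltNge (ltW aa).
have [bb|bb] /= := leP beta b.
  apply: relay_never_off => z /andP[/uab/andP[uz _] _]; exact: le_trans uz.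
have [aut|aut] := ltP alpha (u t); first exact: relay_gt.
apply: relay_off; exists s; split; rewrite ?s0 ?usb//.
by move=> z zst; apply: le_trans aut; exact: umon.
Qed.

(** The first two cases are as on a rising branch. Otherwise, for [alpha < a] the maximum at [s]
    switches the relay on, and it remains on exactly until [u] drops below [beta]. *)
Lemma relay_falling alpha beta a b u m s t : beta < alpha ->
  (forall z, 0 <= z -> b <= u z <= a) -> 0 <= m <= t -> u m = b ->
  0 <= s <= t -> u s = a -> (forall z, s <= z <= t -> u t <= u z) ->
  relay alpha beta u (if alpha <= a then 1 else -1) t =
  if (alpha <= a) && (beta <= b) || ((alpha < a) && (beta <= u t)) then 1 else -1.
Proof.
move=> ba uab m0t umb /andP[s0 st] usa umon; have t0 := le_trans s0 st.
have [aa|aa] /= := leP alpha a; last first.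
  rewrite relay_never_on ?ltNge ?(ltW aa)// => z /andP[/uab/andP[_ uz] _].
  by rewrite (le_trans uz)// ltW.
have [bb|bb] /= := leP beta b.
  apply: relay_never_off => z /andP[/uab/andP[uz _] _]; exact: le_trans uz.
(* For [alpha = a] the input never exceeds the threshold: once switched off at the minimum [m], the
   relay stays off. *)
move: aa; rewrite le_eqVlt => /predU1P[->|aa].
  rewrite ltxx/=; apply: relay_off; exists m; split; rewrite ?umb//.
  by move=> z /andP[mz _]; case/andP: m0t => m0 _; case/andP: (uab z (le_trans m0 mz)).
rewrite aa/=; have [but|but] := leP beta (u t); last exact: relay_lt.
apply: relay_on; exists s; split; rewrite ?s0 ?usa// => z zst.
by apply: le_trans but _; exact: umon.
Qed.

Lemma relay_causal alpha beta u1 u2 r t :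
  (forall z, 0 <= z <= t -> u1 z = u2 z) ->
  relay alpha beta u1 r t = relay alpha beta u2 r t.
Proof.
move=> u12.
(* Both clauses of the relay have this shape, with [P] the switching test and [Q] the memory
   test. *)
have E (P Q : R -> bool) :
    `[< exists s, [/\ 0 <= s <= t, P (u1 s) & forall z, s <= z <= t -> Q (u1 z)] >] =
    `[< exists s, [/\ 0 <= s <= t, P (u2 s) & forall z, s <= z <= t -> Q (u2 z)] >].
  apply/asbool_equiv_eq; split=> -[s [s0t Ps Qs]]; exists s;
    (split => // [|z /[dup] zst /andP[sz zt]];
      [by rewrite ?u12// -?u12|move: (Qs z zst)]);
    by rewrite u12//; move: s0t => /andP[s0 _]; rewrite (le_trans s0 sz).
by rewrite /relay (E (> alpha) (>= beta)) (E (< beta) (<= alpha)).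
Qed.

(** An intermediate value argument; it pulls quantifiers over the times of [u] back along [phi],
    which may fail to be injective. *)
Lemma time_transformation_surj (phi : R -> R) s t x :
  time_transformation phi -> 0 <= s -> s <= t -> phi s <= x <= phi t ->
  exists2 z, s <= z <= t & phi z = x.
Proof.
move=> [cphi mphi _ _] s0 st /andP[sx xt].
have [||z zst phiz] := @IVT _ phi s t x st.
- apply: continuous_subspaceW cphi => z /=; rewrite !in_itv/= andbT => /andP[+ _].
  exact: le_trans.
- have st' : phi s <= phi t by apply: mphi; rewrite ?in_itv/= ?andbT// (le_trans s0).
  by rewrite (min_idPl st') (max_idPr st') sx xt.
- by exists z => //; move: zst; rewrite in_itv.
Qed.

Lemma relay_rate_independent alpha beta u phi r t :
  time_transformation phi -> 0 <= t ->
  relay alpha beta (u \o phi) r t = relay alpha beta u r (phi t).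
Proof.
move=> /[dup] tphi [_ mphi phi0 _] t0.
have mono x y : 0 <= x -> x <= y -> phi x <= phi y.
  by move=> x0 xy; apply: mphi; rewrite ?in_itv/= ?andbT// (le_trans x0).
have E (P Q : R -> bool) :
    `[< exists s, [/\ 0 <= s <= t, P (u (phi s))
                    & forall z, s <= z <= t -> Q (u (phi z))] >] =
    `[< exists s, [/\ 0 <= s <= phi t, P (u s)
                    & forall z, s <= z <= phi t -> Q (u z)] >].
  apply/asbool_equiv_eq; split=> -[s [/andP[s0 st] Ps Qs]].
    exists (phi s); split => //; first by rewrite -{1}phi0 !mono.
    by move=> x /(time_transformation_surj _ _ _ _ tphi s0 st)[z /Qs + <-].
  have [x /andP[x0 xt] phix] : exists2 x, 0 <= x <= t & phi x = s.
    by apply: time_transformation_surj; rewrite // phi0 s0.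
  exists x; split; rewrite ?x0 ?phix// => z /andP[xz zt]; apply: Qs.
  by rewrite -phix !mono// (le_trans x0).
by rewrite /relay /= (E (> alpha) (>= beta)) (E (< beta) (<= alpha)).
Qed.

End Relay.

(** * The Preisach operator is a hysteresis operator; the initial interface *)

Section Operator.
Context {R : realType}.

(** Causality and rate independence pass from each relay to the integral, because the integrands
    agree pointwise. *)
Lemma preisach_hysteresis (mu : R * R -> R) L :
  hysteresis_operator (consistent_inputs L) (preisach mu L).
Proof.
split=> [u1 u2 _ _ tau _ u12 t /andP[t0 ttau]|u phi _ tphi _ t t0].
  apply: eq_Rintegral => p _; congr (_ * _); apply: relay_causal => z /andP[z0 zt].
  by apply: u12; rewrite z0 (le_trans zt).
by apply: eq_Rintegral => p _; rewrite relay_rate_independent.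
Qed.

(** A staircase with a single step, the downward ray from the diagonal point [(a, a)]. It makes the
    initial relay state depend on [alpha] alone. *)
Definition vertical_interface (a : R) : set (R * R) := [set p | p.1 = a /\ p.2 <= a].

Lemma vertical_interfaceP a : interface (vertical_interface a).
Proof.
split; last by move=> p q [-> _] [-> _].
exists (fun g => (a, a - g)); split.
- apply: continuous_subspaceT => x.
  apply: (@cvg_pair _ _ _ (nbhs x) (nbhs a) (nbhs (a - x)) _ _ _ (fun=> a) (fun g => a - g)).
    exact: cvg_cst.
  by apply: cvgB; [exact: cvg_cst|exact: cvg_id].
- by exists a; rewrite subr0.
- by move=> g g0; rewrite /preisach_plane/= ltrBlDr ltrDl.
- apply/cvgryPge => A; near=> g.
  (* In the maximum norm the second coordinate suffices: its absolute value is at least [g - a]. *)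
  rewrite prod_normE/= le_max; apply/orP; right.
  rewrite distrC (le_trans _ (ler_norm _))// lerBrDr.
  by near: g; apply: nbhs_pinfty_ge; rewrite num_real.
- apply/seteqP; split=> [[x y] [/= -> ya]|_ [g /= + <-]].
    by exists (a - y); rewrite ?subKr//= in_itv/= andbT subr_ge0.
  by rewrite in_itv/= andbT => g0; split => //=; rewrite gerBl.
Unshelve. all: by end_near. Qed.

Lemma initial_relay_vertical a (p : R * R) : p.2 < p.1 ->
  initial_relay (vertical_interface a) p = if p.1 <= a then 1 else -1.
Proof.
move=> p21; rewrite /initial_relay; congr (if _ then _ else _).
apply/asboolP/idP => [[q [[-> _] //]]|pa].
by exists (a, a); split => //=; rewrite (le_trans (ltW p21)).
Qed.

End Operator.

(** * Integrals of [mu] against relay states, and the regions where relays are on *)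

Section SignedIntegral.
Context {R : realType}.
Implicit Types (mu : R * R -> R) (a b v : R).

Lemma lebesgue2_vline (v : R) : lebesgue2 R ([set v] `*` setT) = 0%E.
Proof. 
by rewrite product_measure1E// [X in (X * _)%E](_ : _ = 0%E) ?mul0e//;
  exact: lebesgue_measure_set1.
 Qed.

Lemma lebesgue2_hline (v : R) : lebesgue2 R (setT `*` [set v]) = 0%E.
Proof. 
by rewrite product_measure1E// [X in (_ * X)%E](_ : _ = 0%E) ?mule0//;
  exact: lebesgue_measure_set1.
 Qed.

Lemma measurable_setb (f : R * R -> bool) : measurable_fun setT f ->
  measurable [set p | f p].
Proof.
by move=> mf; rewrite -[X in measurable X]setTI; exact: (mf measurableT [set true]).
Qed.

Lemma measurable_preisach_plane : measurable (@preisach_plane R).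
Proof.
by apply: measurable_setb; apply: measurable_fun_ltr;
  [exact: measurable_snd|exact: measurable_fst].
Qed.

(** Reduces an output to the integral of [mu] over the on-region. The remaining term does not
    involve [f], so it cancels when two branches are compared. *)
Lemma Rintegral_sign mu (f : R * R -> bool) : measurable_fun setT f ->
  (lebesgue2 R).-integrable preisach_plane (EFin \o mu) ->
  \int[lebesgue2 R]_(p in preisach_plane) (mu p * (if f p then 1 else -1)) =
  2 * \int[lebesgue2 R]_(p in preisach_plane `&` [set p | f p]) mu p
  - \int[lebesgue2 R]_(p in preisach_plane) mu p.
Proof.
move=> mf imu; have mP := measurable_preisach_plane; have mA := measurable_setb _ mf.
have mPA : measurable (preisach_plane `&` [set p | f p]) by exact: measurableI.
have mPC : measurable (preisach_plane `\` [set p | f p]) by exact: measurableD.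
have disj : [disjoint preisach_plane `&` [set p | f p]
                    & preisach_plane `\` [set p | f p]].
  by apply/disj_setPS => p [[_ fp] [_ /(_ fp)]].
have split_f g : (lebesgue2 R).-integrable preisach_plane (EFin \o g) ->
    \int[lebesgue2 R]_(p in preisach_plane) g p =
    \int[lebesgue2 R]_(p in preisach_plane `&` [set p | f p]) g p +
    \int[lebesgue2 R]_(p in preisach_plane `\` [set p | f p]) g p.
  by move=> ig; rewrite -Rintegral_setU// setUIDK.
rewrite !split_f//; last first.
  (* The signed integrand is integrable, being [mu] times a bounded measurable function. *)
  have : (lebesgue2 R).-integrable preisach_plane
      ((EFin \o mu) \* (EFin \o (fun p => if f p then 1%R else (-1)%R : R)))%E.
    apply: integrableMl => //.
      apply: (@measurable_funS _ _ _ _ setT) => //.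
      by apply: measurable_fun_ifT => //; exact: measurable_cst.
    exists 1; split; first by rewrite num_real.
    by move=> M M1 p _ /=; case: ifP => _; rewrite ?normrN normr1 ltW.
  by apply: eq_integrable => // p _; rewrite /= EFinM.
have -> : \int[lebesgue2 R]_(p in preisach_plane `&` [set p | f p])
    (mu p * (if f p then 1 else -1)) =
    \int[lebesgue2 R]_(p in preisach_plane `&` [set p | f p]) mu p.
  by apply: eq_Rintegral => p /set_mem[_ /= ->]; rewrite mulr1.
have -> : \int[lebesgue2 R]_(p in preisach_plane `\` [set p | f p])
    (mu p * (if f p then 1 else -1)) =
    - \int[lebesgue2 R]_(p in preisach_plane `\` [set p | f p]) mu p.
  rewrite -[RHS]mulN1r -RintegralZl//; last by apply: integrableS imu => // p [].
  by apply: eq_Rintegral => p /set_mem[_ /= /negP/negbTE ->]; rewrite mulrN1 mulN1r.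
lra.
Qed.

Definition rising_on a b v (p : R * R) : bool :=
  (p.1 <= a) && (p.2 <= b) || (p.1 < v).

Definition falling_on a b v (p : R * R) : bool :=
  (p.1 <= a) && (p.2 <= b) || ((p.1 < a) && (p.2 <= v)).

Lemma measurable_rising_on a b v : measurable_fun setT (rising_on a b v).
Proof.
by apply: measurable_or; [apply: measurable_and|];
  [apply: measurable_fun_ler|apply: measurable_fun_ler|apply: measurable_fun_ltr] => //;
  first [exact: measurable_fst|exact: measurable_snd].
Qed.

Lemma measurable_falling_on a b v : measurable_fun setT (falling_on a b v).
Proof.
by apply: measurable_or; apply: measurable_and;
  [apply: measurable_fun_ler|apply: measurable_fun_ler
  |apply: measurable_fun_ltr|apply: measurable_fun_ler] => //;
  first [exact: measurable_fst|exact: measurable_snd].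
Qed.

Lemma measurable_Omega a b v : measurable (Omega a b v).
Proof.
rewrite (_ : Omega a b v = [set p | (p.2 < p.1) && ((v < p.1) && (p.1 < a)
  && ((b < p.2) && (p.2 < v)))]); last first.
  apply/seteqP; split=> p /=; first by move=> [p12 [-> ->]]; rewrite !andbT.
  by move=> /and3P[].
by apply: measurable_setb; do ![apply: measurable_and]; apply: measurable_fun_ltr => //;
  first [exact: measurable_fst|exact: measurable_snd].
Qed.

(* The two on-regions differ by Omega up to the lines alpha = v and beta = v. *)
Lemma Rintegral_falling_rising mu a b v : b <= v <= a ->
  (lebesgue2 R).-integrable preisach_plane (EFin \o mu) ->
  \int[lebesgue2 R]_(p in preisach_plane `&` [set p | falling_on a b v p]) mu p =
  \int[lebesgue2 R]_(p in preisach_plane `&` [set p | rising_on a b v p]) mu p +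
  \int[lebesgue2 R]_(p in Omega a b v) mu p.
Proof.
move=> /andP[bv va] imu; have mP := measurable_preisach_plane.
have mF := measurable_setb _ (measurable_falling_on a b v).
have mS := measurable_setb _ (measurable_rising_on a b v).
have mO := measurable_Omega a b v.
have mPF := measurableI _ _ mP mF; have mPS := measurableI _ _ mP mS.
have OP : preisach_plane `&` [set p | rising_on a b v p] `|` Omega a b v `<=`
    preisach_plane by move=> p [[]|[]].
rewrite -Rintegral_setU//; first last.
(* On [Omega] one has [alpha > v] and [beta > b], which excludes both alternatives of
   [rising_on]. *)
- apply/disj_setPS => p [[_ /=] +] [_ [/andP[vp pa] /andP[bp pv]]].
  by rewrite /rising_on (leNgt p.2) bp andbF/= ltNge (ltW vp).
- by apply: integrableS imu => //; exact: measurableU.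
(* The null set on which the strict and weak inequalities of the two descriptions may disagree. *)
pose N := ([set v] `*` setT) `|` (setT `*` [set v]) : set (R * R).
have mN : measurable N by apply: measurableU; exact: measurableX.
have N0 : lebesgue2 R N = 0%E.
  rewrite measureU0; [exact: lebesgue2_vline|exact: measurableX|exact: measurableX|].
  exact: lebesgue2_hline.
have drop_lines D : measurable D -> D `<=` preisach_plane ->
    \int[lebesgue2 R]_(p in D) mu p = \int[lebesgue2 R]_(p in D `\` N) mu p.
  move=> mD DP; congr fine; apply: negligible_integral => //.
  exact: integrableS imu.
rewrite (drop_lines _ mPF); last by move=> p [].
rewrite [RHS]drop_lines//; last exact: measurableU.
congr (Rintegral _ _ _); apply/seteqP; split => -[x y] [].
  move=> [/= yx xyF] nN; split => //=.
  have xv : x != v by apply/eqP => xv; apply: nN; left.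
  have yv : y != v by apply/eqP => yv; apply: nN; right.
  move: xyF; rewrite /falling_on/= => /orP[H|/andP[xa]].
    by left; split => //=; rewrite /rising_on /= H.
  rewrite le_eqVlt (negbTE yv)/= => yv'.
  (* Off the two lines, a point that is on while falling has [alpha < v], or [beta <= b], or else
     lies in [Omega]. *)
  have [xv'|vx] := ltP x v; first by left; split => //=; rewrite /rising_on/= xv' orbT.
  have [yb|b_y] := leP y b.
    by left; split => //=; rewrite /rising_on/= yb (ltW xa).
  by right; split => //=; rewrite xa b_y yv' lt_neqAle eq_sym xv vx.
(* Conversely, [alpha < v] implies [alpha < a] and, since [beta < alpha] in the plane, also
   [beta <= v]. *)
move=> [[/= yx]|[/= yx [/andP[vx xa] /andP[b_y yv]]]] => [|nN].
  rewrite /rising_on/= => /orP[H|xv] nN; split => //; split => //=.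
    by rewrite /falling_on/= H.
  by rewrite /falling_on/= (lt_le_trans xv va) (ltW (lt_trans yx xv)) orbT.
by split => //; split => //=; rewrite /falling_on/= xa (ltW yv) orbT.
Qed.

End SignedIntegral.

(** * Lipschitz inputs and two-element sets *)

Lemma Lipschitz_AC_Rplus {R : realType} (u : R -> R) (k : R) : 0 < k ->
  (forall x y, `|u x - u y| <= k * `|x - y|) -> AC_Rplus u.
Proof.
move=> k0 lip tau e tau0 e0; exists (e / k); first exact: divr_gt0.
move=> n x y xy _ sumd; apply: (@le_lt_trans _ _ (k * \sum_(i < n) (y i - x i))).
  rewrite mulr_sumr; apply: ler_sum => i _; apply: le_trans (lip _ _) _.
  by rewrite ger0_norm// subr_ge0; have [_ []] := xy i (ltn_ord i).
by rewrite mulrC -ltr_pdivlMr.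
Qed.

Lemma card_eq_set2 (T : choiceType) (x y : T) : x != y -> ([set x; y] #= `I_2)%card.
Proof.
move=> xy; have -> : [set x; y] = [set` [fset x; y]%fset].
  apply/seteqP; split=> z /=; first by case=> ->; rewrite !inE eqxx ?orbT.
  by rewrite !inE => /orP[]/eqP ->; [left|right].
by apply/card_eq_fsetP; rewrite cardfs2 xy.
Qed.

(** * Monotonicity of the cosine on half periods *)

Section Cosine.
Context {R : realType}.
Implicit Types (s t x : R) (n : nat).

Local Notation period n := (@pi R *+ 2 *+ n).

Lemma cos_periodN n t : cos (period n - t) = cos t.
Proof. by rewrite addrC (periodicn (@cosD2pi R)) cosN. Qed.

Lemma period_ge n : (0 < n)%N -> (@pi R) *+ 2 <= period n.
Proof.
case: n => // n _; rewrite [X in _ <= X]mulrSr lerDr.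
by do 2 apply: mulrn_wge0; exact: pi_ge0.
Qed.

Lemma cos_nonincreasing s t : 0 <= s -> s <= t -> t <= pi -> cos t <= cos s.
Proof.
move=> s0 st tpi; rewrite leNgt ltr_cos ?in_itv/=; first by rewrite -leNgt.
  by rewrite (le_trans s0 st).
by rewrite s0 (le_trans st).
Qed.

(** The reflection of [t] to [period n - t] carries this half period to the interval from 0 to [pi]
    and reverses the order. *)
Lemma cos_rising n s t : period n - pi <= s -> s <= t -> t <= period n ->
  cos s <= cos t.
Proof.
move=> ns st tn; rewrite -(cos_periodN n s) -(cos_periodN n t).
by apply: cos_nonincreasing; lra.
Qed.

Lemma cos_falling n s t : period n <= s -> s <= t -> t <= period n + pi ->
  cos t <= cos s.
Proof.
move=> ns st tn; rewrite -(subrK (period n) s) -(subrK (period n) t).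
by rewrite !(periodicn (@cosD2pi R)); apply: cos_nonincreasing; lra.
Qed.

Lemma cos_Lipschitz s t : `|cos s - cos t| <= `|s - t|.
Proof.
wlog st : s t / t <= s.
  move=> H; have [|/ltW] := leP t s; first exact: H.
  by rewrite distrC (distrC s); exact: H.
have [|x _ ->] := @MVT_segment _ (@cos R) (fun x => - sin x) t s st.
  by apply: continuous_subspaceT; exact: continuous_cos.
rewrite normrM ler_piMl// normrN ler_norml.
by rewrite sin_geN1 sin_le1.
Qed.

Lemma half_period t : pi <= t -> exists2 n, (0 < n)%N &
  period n - pi <= t <= period n \/ period n <= t <= period n + pi.
Proof.
move=> pit; have pi0 := pi_gt0 R.
(* The half periods adjacent to the [n]-th maximum cover the times from [period n - pi] to
   [period n + pi]; [t >= pi] makes [n] positive. *)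
pose n := Num.truncn ((t + pi) / (pi *+ 2)).
have pi20 : 0 < (@pi R) *+ 2 by rewrite mulrn_wgt0.
have le1 : 1 <= (t + pi) / (pi *+ 2) by rewrite ler_pdivlMr// mul1r; lra.
have /truncn_itv : 0 <= (t + pi) / (pi *+ 2) by exact: le_trans le1.
rewrite ler_pdivlMr// ltr_pdivrMr// !mulr_natl mulrS -/n => /andP[nt tn].
exists n; first by rewrite truncn_gt0.
by have [tn'|tn'] := leP t (period n); [left|right]; apply/andP; split; lra.
Qed.

End Cosine.

(** * Output, loop and crossing set for the cosine input *)

Section PeriodicInput.
Context {R : realType}.
Context (mu : R * R -> R) (a b : R) (ba : b < a).
Context (imu : (lebesgue2 R).-integrable preisach_plane (EFin \o mu)).

Local Notation period n := (@pi R *+ 2 *+ n).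

Definition cosine_input (t : R) : R := (a + b) / 2 + (a - b) / 2 * cos t.

Local Notation u := cosine_input.

Let r0 : 0 < (a - b) / 2. Proof. by rewrite divr_gt0// subr_gt0. Qed.

Lemma cosine_input_le s t : cos s <= cos t -> u s <= u t.
Proof. by move=> st; rewrite /u lerD2l ler_pM2l. Qed.

Lemma cosine_input_min t : cos t = -1 -> u t = b.
Proof. by rewrite /u => ->; lra. Qed.

Lemma cosine_input_max t : cos t = 1 -> u t = a.
Proof. by rewrite /u => ->; lra. Qed.

Lemma cosine_input_itv t : b <= u t <= a.
Proof.
apply/andP; split.
  by rewrite -(cosine_input_min _ (cospi R)) cosine_input_le// cospi cos_geN1.
by rewrite -(cosine_input_max _ (@cos0 R)) cosine_input_le// cos0 cos_le1.
Qed.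

Lemma cosine_input_periodic n t : u (t + period n) = u t.
Proof. by rewrite /u (periodicn (@cosD2pi R)). Qed.

Lemma cosine_input_periodN n t : u (period n - t) = u t.
Proof. by rewrite /u cos_periodN. Qed.

Lemma cosine_input_surj v : b <= v <= a -> exists2 x, 0 <= x <= pi & u x = v.
Proof.
(* The value the cosine must take for the input to equal [v]. *)
move=> /andP[bv va]; pose x := (v - (a + b) / 2) / ((a - b) / 2).
have x1 : -1 <= x <= 1.
  by rewrite ler_pdivlMr// ler_pdivrMr//; apply/andP; split; lra.
exists (acos x); first by rewrite acos_ge0// acos_lepi.
by rewrite /u acosK ?in_itv// /x [X in _ + X]mulrC divfK ?gt_eqF// addrC subrK.
Qed.

Lemma cosine_input_consistent : consistent_inputs (vertical_interface a) u.
Proof.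
split; last by rewrite (cosine_input_max _ (@cos0 R)); split => /=.
apply: (@Lipschitz_AC_Rplus _ _ ((a - b) / 2)) => // x y.
rewrite /u opprD addrACA subrr add0r -mulrBr normrM gtr0_norm//.
by rewrite ler_pM2l// cos_Lipschitz.
Qed.

Local Notation y := (preisach mu (vertical_interface a) u).

Definition rising_output v :=
  \int[lebesgue2 R]_(p in preisach_plane)
    (mu p * (if rising_on a b v p then 1 else -1)).

Definition falling_output v :=
  \int[lebesgue2 R]_(p in preisach_plane)
    (mu p * (if falling_on a b v p then 1 else -1)).

Lemma falling_rising_output v : b <= v <= a ->
  falling_output v =
  rising_output v + 2 * \int[lebesgue2 R]_(p in Omega a b v) mu p.
Proof.
move=> bva; rewrite /falling_output /rising_output !Rintegral_sign//.
- by rewrite Rintegral_falling_rising//; lra.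
- exact: measurable_rising_on.
- exact: measurable_falling_on.
Qed.

(** The last minimum before [t] is at [period n - pi], which is nonnegative as [n] is positive. The
    output thus depends on the input value only, not on [n]. *)
Lemma output_rising n t : (0 < n)%N -> period n - pi <= t <= period n ->
  y t = rising_output (u t).
Proof.
move=> n0 /andP[nt tn]; apply: eq_Rintegral => p /set_mem p21; congr (_ * _).
have pi0 := pi_gt0 R.
have nge := @period_ge R n n0.
rewrite initial_relay_vertical// (@relay_rising _ _ _ _ b _ (period n - pi))//.
- by move=> z _; exact: cosine_input_itv.
- by rewrite nt andbT; lra.
- by apply: cosine_input_min; rewrite cos_periodN cospi.
- by move=> z /andP[nz zt]; apply: cosine_input_le; exact: (cos_rising n).
Qed.

Lemma output_falling n t : (0 < n)%N -> period n <= t <= period n + pi ->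
  y t = falling_output (u t).
Proof.
move=> n0 /andP[nt tn]; apply: eq_Rintegral => p /set_mem p21; congr (_ * _).
have pi0 := pi_gt0 R.
have nge := @period_ge R n n0.
(* The minimum at [pi] precedes [period n], the time of the last maximum before [t]. *)
rewrite initial_relay_vertical// (@relay_falling _ _ _ _ b _ pi (period n))//.
- by move=> z _; exact: cosine_input_itv.
- by apply/andP; split; lra.
- by apply: cosine_input_min; rewrite cospi.
- by rewrite nt andbT; lra.
- by apply: cosine_input_max; rewrite -[period n]subr0 cos_periodN cos0.
- by move=> z /andP[nz zt]; apply: cosine_input_le; apply: (cos_falling n) => //; lra.
Qed.

Lemma output_periodic t : pi <= t -> y (t + pi *+ 2) = y t.
Proof.
move=> /half_period[n n0 tn].
have uE : u (t + pi *+ 2) = u t by rewrite -[pi *+ 2]mulr1n cosine_input_periodic.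
case: tn => tn.
  rewrite (@output_rising n t)// (@output_rising n.+1) ?uE//.
  by rewrite mulrSr; move: tn => /andP[? ?]; apply/andP; split; lra.
rewrite (@output_falling n t)// (@output_falling n.+1) ?uE//.
by rewrite mulrSr; move: tn => /andP[? ?]; apply/andP; split; lra.
Qed.

(** The fibre of the orbit over [v] consists of one rising and one falling output, and these differ
    by twice the nonzero integral over [Omega]. *)
Lemma cosine_loop v : b <= v <= a ->
  \int[lebesgue2 R]_(p in Omega a b v) mu p <> 0 -> is_loop (Defs.orbit pi u y).
Proof.
move=> bva F0; exists v; have pi0 := pi_gt0 R.
rewrite (_ : [set p | _] = [set (v, rising_output v); (v, falling_output v)]).
  apply: card_eq_set2; apply/eqP => -[E]; apply: F0.
  by move: (falling_rising_output _ bva); lra.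
apply/seteqP; split=> [_ [[t /= + <-] /= utv]|p].
  rewrite in_itv/= andbT => /half_period[n n0 [tn|tn]].
    by left; rewrite (output_rising _ _ n0 tn) utv.
  by right; rewrite (output_falling _ _ n0 tn) utv.
(* With [x] between 0 and [pi], the times [period 1 - x] and [x + period 1] reach the value [v] on
   the first rising and the following falling branch. *)
have [x /andP[x0 xpi] uxv] := cosine_input_surj v bva.
case=> ->; split => //.
  exists (period 1 - x); first by rewrite /= in_itv/= andbT; lra.
  rewrite (@output_rising 1) ?cosine_input_periodN ?uxv//.
  by apply/andP; split; lra.
exists (x + period 1); first by rewrite /= in_itv/= andbT; lra.
rewrite (@output_falling 1) ?cosine_input_periodic ?uxv//.
by apply/andP; split; lra.
Qed.

Let crossing := graph_on `[pi, pi *+ 2] u y `&` graph_on `[pi *+ 2, pi + pi *+ 2] u y.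

Lemma crossing_Omega p : crossing p ->
  \int[lebesgue2 R]_(q in Omega a b p.1) mu q = 0.
Proof.
move=> [[t /= + <-] [t' /= + [ut]]]; rewrite !in_itv/= => /andP[t1 t2] /andP[t2' t3].
rewrite (@output_rising 1 t) ?(@output_falling 1 t')//; first last.
- by apply/andP; split; lra.
- by apply/andP; split; lra.
rewrite ut falling_rising_output; last exact: cosine_input_itv.
lra.
Qed.

Lemma Omega_crossing v : b <= v <= a ->
  \int[lebesgue2 R]_(q in Omega a b v) mu q = 0 -> crossing (v, rising_output v).
Proof.
move=> bva F0; have pi0 := pi_gt0 R.
have [x /andP[x0 xpi] uxv] := cosine_input_surj v bva; split.
  exists (period 1 - x); first by rewrite /= in_itv/=; apply/andP; split; lra.
  rewrite (@output_rising 1) ?cosine_input_periodN ?uxv//.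
  by apply/andP; split; lra.
exists (x + period 1); first by rewrite /= in_itv/=; apply/andP; split; lra.
rewrite (@output_falling 1) ?cosine_input_periodic ?uxv//.
  by rewrite falling_rising_output// F0 mulr0 addr0.
by apply/andP; split; lra.
Qed.

(** The first projection of the component is connected in the line, hence an interval; it contains
    [v] but neither [v0] nor [v1], over which the branches do not meet. *)
Lemma crossing_component v0 v v1 q : v0 < v < v1 ->
  \int[lebesgue2 R]_(p in Omega a b v0) mu p <> 0 ->
  \int[lebesgue2 R]_(p in Omega a b v1) mu p <> 0 ->
  connected_component crossing (v, rising_output v) q -> v0 < q.1 < v1.
Proof.
move=> /andP[v0v vv1] F0 F1 Cq.
(* The base point lies in its component because that component contains [q]. *)
have Cp : connected_component crossing (v, rising_output v) (v, rising_output v).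
  exact: connected_component_sym (connected_component_trans Cq (connected_component_sym Cq)).
have itvC : is_interval (fst @` connected_component crossing (v, rising_output v)).
  apply/connected_intervalP; apply: connected_continuous_connected.
    exact: component_connected.
  by apply: continuous_subspaceT => x; exact: cvg_fst.
have no_zero w : \int[lebesgue2 R]_(p in Omega a b w) mu p <> 0 ->
    ~ (fst @` connected_component crossing (v, rising_output v)) w.
  by move=> Fw [p /connected_component_sub/crossing_Omega + pw]; rewrite pw.
have Cv : (fst @` connected_component crossing (v, rising_output v)) v.
  by exists (v, rising_output v).
have Cq1 : (fst @` connected_component crossing (v, rising_output v)) q.1.
  by exists q.
apply/andP; split; rewrite ltNge; apply/negP => qv.
  by apply: (no_zero _ F0); apply: (itvC _ _ Cq1 Cv); rewrite qv ltW.
by apply: (no_zero _ F1); apply: (itvC _ _ Cv Cq1); rewrite qv ltW.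
Qed.

End PeriodicInput.

(** * The multi-loop property *)

Theorem mainTheorem3 (R : realType) (mu : R * R -> R)
    (alpha0 beta0 alpha1m alpha1 alpha1p : R)
    (hmu : weighting_function mu)
    (hP : preisach_plane (alpha0, beta0))
    (h01 : beta0 < alpha1m) (h11 : alpha1m < alpha1)
    (h12 : alpha1 < alpha1p) (h10 : alpha1p < alpha0)
    (hzero : \int[lebesgue2 R]_(p in Omega alpha0 beta0 alpha1) mu p = 0)
    (hminus : \int[lebesgue2 R]_(p in Omega alpha0 beta0 alpha1m) mu p <> 0)
    (hplus : \int[lebesgue2 R]_(p in Omega alpha0 beta0 alpha1p) mu p <> 0) :
  preisach_multi_loop mu.
Proof.
have [_ imu] := hmu; have pi0 := pi_gt0 R; have ba : beta0 < alpha0 := hP.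
have umin : cosine_input alpha0 beta0 pi = beta0.
  by apply: cosine_input_min; exact: cospi.
have umax : cosine_input alpha0 beta0 (pi *+ 2) = alpha0.
  by apply: cosine_input_max; exact: cos2pi.
split=> [L _|]; first exact: preisach_hysteresis.
exists (vertical_interface alpha0), (cosine_input alpha0 beta0).
split; [exact: vertical_interfaceP|exact: cosine_input_consistent|].
(* The period is twice [pi]; the output is observed from the first minimum, at [pi], and the next
   maximum is at twice [pi]. *)
exists (pi *+ 2), pi, pi, (pi *+ 2); split => //.
- split; [by rewrite mulrn_wgt0| |exact: ltW|by move=> t; exact: output_periodic].
  by move=> t _; rewrite -[pi *+ 2]mulr1n cosine_input_periodic.
(* The nonzero integral at [alpha1m] supplies a fibre with exactly two points. *)
- apply: (@cosine_loop _ _ _ _ ba imu alpha1m) => //.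
  by apply/andP; split; lra.
- split.
  + by apply/andP; split; lra.
  + move=> s t; rewrite !in_itv/= => /andP[s1 _] /andP[_ t2] st.
    by apply: cosine_input_le => //; apply: (@cos_rising _ 1) => //; lra.
  + move=> s t; rewrite !in_itv/= => /andP[_ s3] /andP[t2 _] ts.
    by apply: cosine_input_le => //; apply: (@cos_falling _ 1) => //; lra.
- exists (alpha1, rising_output mu alpha0 beta0 alpha1).
    by apply: Omega_crossing => //; apply/andP; split; lra.
  (* The component over [alpha1] stays between [alpha1m] and [alpha1p], hence away from the extreme
     input values [beta0] and [alpha0]. *)
  move=> q /(@crossing_component _ _ _ _ ba imu alpha1m _ alpha1p).
  rewrite h11 h12 umin umax => /(_ isT hminus hplus)/andP[mq qp].
  by split; [rewrite gt_eqF ?(lt_trans h01)|rewrite lt_eqF ?(lt_trans qp)].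
Qed.
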